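(* Let $Sp$ be an unbalanced split graph. Then $\operatorname{Supp}(Sp)$ is contained in the intersection of all the maximum independent sets of $Sp$.
   Context: Graphs are finite and simple. A split graph is a graph $Sp$ with at least one vertex whose vertex set is a disjoint union of a clique $K$ and an independent set $S$; such a pair $(K,S)$ is called an s-partition for $Sp$ (here one of the two parts may be empty). $\omega(Sp)$ and $\alpha(Sp)$ are the clique number and independence number. A split graph with s-partition $(K,S)$ is balanced if $|K|=\omega(Sp)$ and $|S|=\alpha(Sp)$, and unbalanced otherwise (this does not depend on the s-partition chosen). A maximum independent set is an independent set of size $\alpha(Sp)$. $\operatorname{Supp}(Sp)$ is the set of vertices $v$ such that $x_v\ne 0$ for some real vector $x$ in the nullspace of the adjacency matrix of $Sp$. *)

(* Defs.v *)
From HB Require Import structures.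
From mathcomp Require Import all_boot all_order all_algebra.
From mathcomp Require Import reals.

Set Implicit Arguments.
Unset Strict Implicit.
Unset Printing Implicit Defensive.

Import GRing.Theory.
Local Open Scope ring_scope.

Record sgraph := SGraph {
  vertex :> finType;
  adj : rel vertex;
  adj_sym : symmetric adj;
  adj_irr : irreflexive adj
}.

Section Graph.
Variable G : sgraph.
Implicit Types A K S : {set G}.

Definition clique A : bool :=
  [forall u in A, forall v in A, (u != v) ==> adj u v].

Definition independent A : bool :=
  [forall u in A, forall v in A, ~~ adj u v].

Definition clique_number : nat := \max_(A : {set G} | clique A) #|A|.

Definition independence_number : nat :=
  \max_(A : {set G} | independent A) #|A|.

Definition max_independent A : bool :=
  independent A && (#|A| == independence_number).

Definition s_partition K S : bool :=
  [&& K :|: S == [set: G], [disjoint K & S], clique K & independent S].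

(* The parts of an s-partition may be empty, but G may not. *)
Definition split_graph : Prop :=
  (0 < #|G|)%N /\ exists K S, s_partition K S.

(* Meant for an s-partition (K, S) of G; the value does not depend on which
   s-partition of G is used. *)
Definition balanced K S : bool :=
  (#|K| == clique_number) && (#|S| == independence_number).

(* Since balancedness does not depend on the s-partition, one witness is
   enough here. *)
Definition unbalanced_split_graph : Prop :=
  split_graph /\ exists K S, s_partition K S /\ ~~ balanced K S.

(* Vertices are numbered by [enum_rank]. *)
Definition adjacency_matrix (R : realType) : 'M[R]_#|G| :=
  \matrix_(i, j) (adj (enum_val i) (enum_val j))%:R.

Definition Supp (R : realType) (v : G) : Prop :=
  exists x : 'cV[R]_#|G|,
    adjacency_matrix R *m x = 0 /\ x (enum_rank v) ord0 != 0.

End Graph.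

(* Main.v *)
Require Import Defs.
From HB Require Import structures.
From mathcomp Require Import all_boot all_order all_algebra.
From mathcomp Require Import reals.

(** An unbalanced split graph has an s-partition (K, S) with #|S| below the
    independence number; then every maximum independent set is u |: S for some
    u in K without neighbours in S.  Let x be in the nullspace, let B be the
    K-by-S block of the adjacency matrix and s the sum of x over K.  The rows
    in K read x_K = s 1 + B x_S and the rows in S read B^T x_K = 0, so pairing
    the first equation with x_K gives |x_K|^2 = s^2, while the row of u gives
    x_u = s.  Hence x vanishes on K outside u. *)

Import GRing.Theory Num.Theory.

(** Outside [X] the set [Y] lies in [Z], so it has at most one element there; to be larger than [X]
    it must then contain all of [X]. Used twice with the two parts of an s-partition as [X] and [Z]:
    for a clique larger than [K] and for an independent set larger than [S]. *)
Lemma card_ltn_setU1 (T : finType) (X Y Z : {set T}) :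
  X :|: Z = [set: T] -> #|Y :&: Z| <= 1 -> #|X| < #|Y| ->
  exists2 w, w \in Z :\: X & Y = w |: X.
Proof.
move=> XZ YZ XY.
have YXZ : Y :\: X \subset Y :&: Z.
  apply/subsetP => y; rewrite !inE => /andP[yX ->] /=.
  by have := in_setT y; rewrite -XZ inE (negPf yX).
have le1 : #|Y :\: X| <= 1 := leq_trans (subset_leq_card YXZ) YZ.
(* Counting: [#|X| + 1 <= #|Y| = #|X :&: Y| + #|Y :\: X| <= #|X :&: Y| + 1]. *)
have XsY : X \subset Y.
  apply/setIidPr/eqP; rewrite eqEcard subsetIr /= -(leq_add2r 1).
  rewrite addn1 (leq_trans XY) // -(cardsID X Y).
  by rewrite leq_add2l.
have /cards1P[w Yw] : #|Y :\: X| == 1.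
  by rewrite eqn_leq le1 /= cardsD (setIidPr XsY) subn_gt0.
have wYX : w \in Y :\: X by rewrite Yw set11.
exists w.
  move/(subsetP YXZ): (wYX); move: wYX; rewrite !inE.
  by move=> /andP[-> _] /andP[_ ->].
by rewrite -Yw setUC -{1}(setID Y X) (setIidPr XsY).
Qed.

Section SplitGraph.
Set Implicit Arguments.
Unset Strict Implicit.
Variable G : sgraph.
Implicit Types (A C I K S : {set G}) (u v w y : G).

Lemma cliqueP A :
  reflect {in A &, forall u v, u != v -> adj u v} (clique A).
Proof.
apply: (iffP forall_inP) => [h u v uA vA | h u uA].
  by move/forall_inP: (h u uA) => /(_ v vA)/implyP.
by apply/forall_inP => v vA; apply/implyP; exact: h.
Qed.

Lemma independentP A :
  reflect {in A &, forall u v, ~~ adj u v} (independent A).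
Proof.
apply: (iffP forall_inP) => [h u v uA vA | h u uA].
  by move/forall_inP: (h u uA) => /(_ v vA).
by apply/forall_inP => v vA; exact: h.
Qed.

Lemma card_clique_independent C I :
  clique C -> independent I -> #|C :&: I| <= 1.
Proof.
move=> /cliqueP cC /independentP iI; apply/card_le1_eqP => u v.
rewrite !inE => /andP[uC uI] /andP[vC vI]; apply/eqP/negPn/negP => uv.
by have /negP := iI u v uI vI; apply; apply: cC => //; rewrite eq_sym.
Qed.

Lemma card_clique C : clique C -> #|C| <= clique_number G.
Proof. exact: (@leq_bigmax_cond _ _ (fun A : {set G} => #|A|)). Qed.

Lemma card_independent I : independent I -> #|I| <= independence_number G.
Proof. exact: (@leq_bigmax_cond _ _ (fun A : {set G} => #|A|)). Qed.

(** If [S] is already maximum, then [K] is not, and a larger clique must be [w |: K] with [w] in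
    [S]. Moving [w] from [S] to [K] gives another s-partition, whose independent part is one
    smaller. *)
Lemma unbalanced_small_independent :
  unbalanced_split_graph G ->
  exists K S, s_partition K S /\ #|S| < independence_number G.
Proof.
case=> _ [K [S [KS]]]; have /and4P[/eqP UKS dKS cK iS] := KS.
rewrite negb_and; case/orP => neq; last first.
  by exists K, S; split=> //; rewrite ltn_neqAle neq card_independent.
have [C cC KC] : exists2 C : {set G}, clique C & #|K| < #|C|.
  have ltK : #|K| < clique_number G by rewrite ltn_neqAle neq card_clique.
  have [|C cC eC] :=
    @eq_bigmax_cond _ (mem (@clique G)) (fun A : {set G} => #|A|).
    by apply/card_gt0P; exists K.
  by exists C => //; rewrite -eC.
have [w /setDP[wS wK] eC] :=
  card_ltn_setU1 _ _ _ _ UKS (card_clique_independent cC iS) KC.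
exists (w |: K), (S :\ w); split; last first.
  by apply: leq_trans (card_independent iS); rewrite (cardsD1 w S) wS.
apply/and4P; split.
- by rewrite -setUA setUCA setD1K // UKS.
- rewrite disjoints_subset; apply/subsetP => z; rewrite !inE.
  by case: eqVneq => //= _ /(disjointFr dKS) ->.
- by rewrite -eC.
- by apply/independentP => a b /setD1P[_ aS] /setD1P[_ bS];
    move/independentP: iS; apply.
Qed.

Lemma max_independent_setU1 K S I :
    s_partition K S -> #|S| < independence_number G -> max_independent I ->
  exists u, [/\ u \in K, {in S, forall y, ~~ adj u y} & I = u |: S].
Proof.
move=> /and4P[/eqP UKS dKS cK iS] ltS /andP[iI /eqP cI].
rewrite setUC in UKS; rewrite -cI in ltS.
have IK : #|I :&: K| <= 1 by rewrite setIC card_clique_independent.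
have [u /setDP[uK _] eI] := card_ltn_setU1 _ _ _ _ UKS IK ltS.
(* Both [u] and [y] lie in the independent set [I]. *)
exists u; split=> // y yS; move/independentP: iI; apply.
- by rewrite eI setU11.
- by rewrite eI setU1r.
Qed.

Local Open Scope ring_scope.

Lemma kernel_eq0 (R : realDomainType) K S u (f : G -> R) :
    s_partition K S -> u \in K -> {in S, forall y, ~~ adj u y} ->
    (forall v, \sum_w (adj v w)%:R * f w = 0) ->
  {in K, forall v, v != u -> f v = 0}.
Proof.
move=> /and4P[/eqP UKS dKS /cliqueP cK /independentP iS] uK uS ker.
pose s := \sum_(v in K) f v.
have split v : \sum_(w in K) (adj v w)%:R * f w
             + \sum_(w in S) (adj v w)%:R * f w = 0.
  rewrite -[RHS](ker v) [RHS](bigID (mem K)) /=; congr (_ + _).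
  apply: eq_bigl => w; have := in_setT w; rewrite -UKS inE.
  by case: (boolP (w \in K)) => [/(disjointFr dKS) -> | _ /= ->].
(* Since [K] is a clique, the sum over [K] in the row of [v] is [s - f v]: only the diagonal term is
   missing. *)
have rowK v : v \in K -> f v = s + \sum_(w in S) (adj v w)%:R * f w.
  move=> vK; rewrite -[LHS]addr0 -[X in _ + X = _](split v) addrA; congr (_ + _).
  rewrite /s !(bigD1 v vK) /= adj_irr mul0r add0r; congr (_ + _).
  apply: eq_bigr => w /andP[wK wv].
  by rewrite (cK v w) ?mul1r // eq_sym.
have rowS y : y \in S -> \sum_(w in K) (adj y w)%:R * f w = 0.
  move=> yS; rewrite -[LHS]addr0 -[RHS](split y); congr (_ + _).
  by rewrite big1 // => w wS; rewrite (negPf (iS _ _ yS wS)) mul0r.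
have fu : f u = s.
  rewrite (rowK u uK) big1 ?addr0 // => w wS.
  by rewrite (negPf (uS _ wS)) mul0r.
have sq : \sum_(v in K) f v ^+ 2 = s ^+ 2.
  under eq_bigr => v vK do rewrite expr2 {1}(rowK v vK) mulrDl.
  rewrite big_split /= -mulr_sumr -expr2.
  under [X in _ + X = _]eq_bigr => v _ do rewrite mulr_suml.
  (* In the exchanged cross term, the summand at [y] is [f y] times the row of [y], which vanishes
     by [rowS]; symmetry of [adj] matches the two. *)
  rewrite exchange_big /= [X in _ + X]big1 ?addr0 // => y yS.
  rewrite -[RHS](mulr0 (f y)) -[X in _ * X](rowS y yS) mulr_sumr.
  by apply: eq_bigr => v _; rewrite adj_sym mulrAC mulrC.
(* The term of [u] is [s ^+ 2] and cancels the right-hand side, so the squares over the rest of [K]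
   sum to zero and each of them is zero. *)
move: sq; rewrite (bigD1 u uK) /= fu => /eqP.
rewrite -subr_eq0 addrAC subrr add0r psumr_eq0 =>
  [/allP h v vK vu|v _]; last first.
  exact: sqr_ge0.
have /implyP := h v (mem_index_enum v).
by rewrite sqrf_eq0 => fv; apply/eqP/fv/andP; split.
Qed.

Lemma adjacency_kernel_sum (R : realType) (x : 'cV[R]_#|G|) v :
    adjacency_matrix G R *m x = 0 ->
  \sum_w (adj v w)%:R * x (enum_rank w) ord0 = 0.
Proof.
move/matrixP/(_ (enum_rank v) ord0); rewrite !mxE => Axv; rewrite -[RHS]Axv.
rewrite (reindex enum_rank) /=; last exact/onW_bij/enum_rank_bij.
by apply: eq_bigr => w _; rewrite mxE !enum_rankK.
Qed.

End SplitGraph.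

Theorem theorem4p9 (R : realType) (Sp : sgraph)
    (hSp : unbalanced_split_graph Sp) (v : Sp) (hv : Supp R v) :
  v \in \bigcap_(I : {set Sp} | max_independent I) I.
Proof.
have [K [S [KS ltS]]] := unbalanced_small_independent hSp.
case: hv => x [Ax xv]; apply/bigcapP => I maxI.
have [u [uK uS ->]] := max_independent_setU1 KS ltS maxI.
have /and4P[/eqP UKS _ _ _] := KS.
(* A vertex of [S] lies in [u |: S] at once; one of [K] other than [u] would contradict [xv]. *)
have := in_setT v; rewrite -UKS !inE => /orP[vK | ->]; last by rewrite orbT.
case: eqVneq => //= vu; move: xv.
by rewrite (kernel_eq0 KS uK uS (fun w => adjacency_kernel_sum w Ax) vK vu) eqxx.
Qed.
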